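(* Let $\Gamma$ be a Lewis graph with vertex partition \[ V(\Gamma)=U\sqcup X\sqcup Y,\qquad |U|=n_1,\ |X|=n_2,\ |Y|=n_3, \] satisfying the following structural conditions: (i) the induced subgraphs $\Gamma[U]$, $\Gamma[X]$ and $\Gamma[Y]$ are complete; (ii) every vertex $u\in U$ is adjacent to all vertices in $X\cup Y$; (iii) for each $x\in X$ there is exactly one $y\in Y$ such that $xy\notin E(\Gamma)$, and this assignment is given by a surjective map $f\colon X\to Y$; (iv) $B_{XY}\in\{0,1\}^{n_2\times n_3}$ denotes the bipartite defect matrix, defined by $(B_{XY})_{x,y}=1$ if $xy\notin E(\Gamma)$ and $(B_{XY})_{x,y}=0$ otherwise, and $r=\operatorname{rank}(B_{XY})$ over $\mathbb{Q}$. Let $A$ be the adjacency matrix of $\Gamma$, let $n=n_1+n_2+n_3$, and let $\chi_A(\lambda)=\det(\lambda I-A)$. Then the following hold. (a) The eigenvalue $-1$ of $A$ occurs with multiplicity at least $\max\{0,\,n-1-2r\}$. (b) At most $2r+1$ eigenvalues of $A$ differ from $-1$ (counting algebraic multiplicities). (c) Every irreducible factor of $\chi_A(\lambda)\in\mathbb{Q}[\lambda]$ corresponding to eigenvalues not equal to $-1$ has degree at most $2r+1$. (d) If $K$ is the splitting field of $\chi_A(\lambda)$ over $\mathbb{Q}$, then \[ [K:\mathbb{Q}]\le (2r+1)^{2r+1}. \]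
   Context: All graphs are finite and simple. A graph $\Gamma$ on $n$ vertices is called a Lewis graph if its set of vertices of degree less than $n-1$ can be partitioned into two sets, each inducing a complete subgraph, one of which consists entirely of vertices of degree $n-2$. In the partition above, $U$ plays the role of the set of universal vertices (degree $n-1$), $X$ consists of non-universal vertices of degree $n-2$, and $Y$ consists of the remaining non-universal vertices. *)

(* Defs.v *)
From HB Require Import structures.
From mathcomp Require Import all_boot all_order all_algebra all_field.

Set Implicit Arguments.
Unset Strict Implicit.
Unset Printing Implicit Defensive.

Import Order.TTheory GRing.Theory Num.Theory.

Local Open Scope ring_scope.

(* A finite simple graph is a symmetric irreflexive relation [e] on a finite  *)
(* type [T] of vertices.                                                      *)

Section Graphs.

Variables (T : finType) (e : rel T).

Definition degree (v : T) : nat := #|[set w | e v w]|.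

Definition induces_complete (S : {set T}) : Prop :=
  {in S &, forall v w, v != w -> e v w}.

(* The conditions deg v = n - 1, deg v < n - 1 and deg v = n - 2 are written  *)
(* without subtraction, which is truncated on nat.                            *)
Definition universal_vertices : {set T} := [set v | (degree v).+1 == #|T|].
Definition nonuniversal_vertices : {set T} := [set v | (degree v).+1 < #|T|]%N.

(* The blocks X and Y are allowed to be empty.                                *)
Definition lewis_blocks (X Y : {set T}) : Prop :=
  [/\ X :|: Y = nonuniversal_vertices,
      [disjoint X & Y],
      induces_complete X,
      induces_complete Y
    & {in X, forall x, (degree x).+2 = #|T|}].

Definition lewis_graph : Prop := exists X Y : {set T}, lewis_blocks X Y.

Definition vertex_partition (U X Y : {set T}) : Prop :=
  [/\ U :|: X :|: Y = [set: T],
      [disjoint U & X], [disjoint U & Y] & [disjoint X & Y]].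

(* Rows and columns are indexed along the enumeration of T (resp. X and Y);   *)
(* characteristic polynomial and rank do not depend on it.                    *)
Definition adjacency_mx : 'M[rat]_#|T| :=
  \matrix_(i, j) (e (enum_val i) (enum_val j))%:R.

Definition defect_mx (X Y : {set T}) : 'M[rat]_(#|X|, #|Y|) :=
  \matrix_(i < #|X|, j < #|Y|) (~~ e (enum_val i) (enum_val j))%:R.

End Graphs.

(* The complex eigenvalues, repeated according to algebraic multiplicity.     *)
(* They all lie in algC because the entries are rational.                     *)
Definition eigenvalues (n : nat) (A : 'M[rat]_n) : seq algC :=
  sval (closed_field_poly_normal (map_poly ratr (char_poly A) : {poly algC})).

Lemma eigenvaluesP (n : nat) (A : 'M[rat]_n) :
  map_poly ratr (char_poly A) = \prod_(z <- eigenvalues A) ('X - z%:P).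
Proof.
rewrite /eigenvalues; case: closed_field_poly_normal => s /= def_s.
by rewrite [LHS]def_s (monicP _) ?scale1r // map_monic char_poly_monic.
Qed.

(* Main.v *)
Require Import Defs.
From HB Require Import structures.
From mathcomp Require Import all_boot all_order all_algebra all_field.
From mathcomp Require Import zify.

Set Implicit Arguments.
Unset Strict Implicit.
Unset Printing Implicit Defensive.

Import Order.TTheory GRing.Theory Num.Theory.

Local Open Scope ring_scope.

(* Adding 1 to the adjacency matrix turns it into the all-ones matrix minus   *)
(* the non-adjacency matrix, and the latter is the block matrix with          *)
(* off-diagonal blocks B and B^T; hence rank (A + 1) <= 2r + 1.  So           *)
(* chi = q * (X + 1)^(n - 2r - 1) with deg q <= 2r + 1.  The splitting field  *)
(* is obtained by adjoining at most 2r + 1 roots of q, each multiplying the   *)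
(* dimension by at most deg q.                                                *)

(** All four claims come from one rank bound. The corank of [A + 1] bounds from below the algebraic
    multiplicity of -1 ([exp_rank_dvdp_char_poly]), and [rank_adjacency_mxD1] makes this corank at
    least n - 2r - 1. This is (a), and (b) counts the remaining roots. For (c), an irreducible
    factor with a root other than -1 is coprime to X + 1, hence divides q. For (d), adjoining -1
    costs nothing, so only the at most 2r + 1 roots outside the base field enlarge the dimension. *)

Lemma exp_rank_dvdp_char_poly (F : fieldType) (n : nat) (A : 'M[F]_n) (a : F) :
  ('X - a%:P) ^+ (n - \rank (A - a%:M)) %| char_poly A.
Proof.
set B := A - a%:M; set k := \rank B; set W := invmx (col_ebase B).
(* [W] undoes the column part of the rank decomposition of [B], so [W *m B] is zero from row [k] on.
   Its determinant is a nonzero constant, harmless for divisibility. *)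
have W_unit : \det W != 0 by rewrite -unitfE -unitmxE unitmx_inv col_ebase_unit.
have WB : W *m B = pid_mx k *m row_ebase B.
  by rewrite -[in LHS](mulmx_ebase B) -mulmxA mulKmx ?col_ebase_unit.
rewrite /char_poly; have -> : char_poly_mx A = ('X - a%:P)%:M - map_mx polyC B.
  by rewrite /char_poly_mx /B map_mxB map_scalar_mx raddfB /= opprB addrA subrK.
(* Multiplying by W on the left makes every row of index at least k a         *)
(* multiple of X - a.                                                         *)
rewrite -(@dvdpZr _ (\det W)) // -mul_polyC -det_map_mx -det_mulmx.
rewrite mulmxBr -map_mxM WB mul_mx_scalar /determinant.
elim/big_ind: _ => [|p q|s _]; [exact: dvdp0|exact: dvdp_add|].
apply: dvdp_mull.
(* Spread over the rows, the power can be compared factor by factor with a term of the Leibniz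
   expansion. *)
have -> : ('X - a%:P) ^+ (n - k) =
    \prod_(i < n) (if (k <= i)%N then 'X - a%:P else 1).
  rewrite -big_mkcond prodr_const; congr (_ ^+ _).
  rewrite -sum1_card (eq_bigl (fun i : 'I_n => (k <= i)%N)) //.
  rewrite -(big_mkord (fun i => k <= i)%N (fun=> 1%N)).
  rewrite (big_cat_nat _ (n := k)) ?rank_leq_row //= big_nat_cond.
  rewrite big_pred0; last by move=> i; rewrite ltnNge; case: (k <= i)%N.
  rewrite add0n big_nat_cond (eq_bigl (fun i => k <= i < n)%N); last first.
    by move=> i /=; case: (k <= i)%N; rewrite ?andbT.
  by rewrite -big_nat sum_nat_const_nat muln1.
elim/big_ind2: _ => [|p1 q1 p2 q2|i _]; [exact: dvdpp|exact: dvdp_mul|].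
case: leqP => [le_k_i|_]; last exact: dvd1p.
rewrite !mxE big1 => [|j _]; first by rewrite subr0 dvdp_mulr.
by rewrite mxE ltnNge le_k_i andbF mul0r.
Qed.

(** Tower law: adjoining z multiplies the dimension by the degree of its minimal polynomial over the
    current field. That degree is 1 for z in the base field, and otherwise at most deg q, since q
    has coefficients in every field of the tower. *)
Lemma dim_adjoin_seq_leq (F : fieldType) (L : fieldExtType F) (d : nat)
    (q : {poly L}) (rs : seq L) :
    q \is a polyOver 1%VS -> q != 0 -> (size q <= d.+1)%N -> (0 < d)%N ->
    {in rs, forall z, root q z || (z \in 1%VS)} ->
  (\dim <<1 & rs>> <= d ^ count [pred z | z \notin 1%VS] rs)%N.
Proof.
move=> q_over q_neq0 sz_q d_gt0.
elim/last_ind: rs => [|rs z IHrs] q_rs.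
  by rewrite adjoin_nil subfield_closed dimv1.
rewrite adjoin_rcons dim_Fadjoin -cats1 count_cat /= addn0 expnD mulnC.
apply: leq_mul.
  by apply: IHrs => x rs_x; apply: q_rs; rewrite mem_rcons inE rs_x orbT.
have le1E : (1 <= <<1 & rs>>)%VS by exact: subv_adjoin_seq.
have [z1|z_notin1] /= := boolP (z \in 1%VS).
  by rewrite (eqP (_ : adjoin_degree _ z == 1)) // adjoin_deg_eq1 (subvP le1E).
have qz : root q z.
  by have := q_rs z; rewrite mem_rcons mem_head (negPf z_notin1) orbF; apply.
rewrite expn1 -ltnS -size_minPoly (leq_trans _ sz_q) ?dvdp_leq ?minPoly_dvdp //.
by apply: polyOverS q_over => x; apply: (subvP le1E).
Qed.

(** The sequence [rs] has deg p entries, and the multiplicity of [f a] accounts for at least deg p -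
    k of them. This is used for the complex eigenvalues and again for the roots in the splitting
    field. *)
Lemma count_split_roots_neq (F F' : fieldType) (f : {rmorphism F -> F'})
    (p : {poly F}) (a : F) (k : nat) (rs : seq F') :
    p != 0 -> ('X - a%:P) ^+ ((size p).-1 - k) %| p ->
    map_poly f p %= \prod_(z <- rs) ('X - z%:P) ->
  (count [pred z | z != f a] rs <= k)%N.
Proof.
move=> p_neq0 dvd_p eqp_p.
have sz_rs : (size p).-1 = size rs.
  by have := eqp_size eqp_p; rewrite size_map_poly size_prod_XsubC => ->.
have prod_neq0 : \prod_(z <- rs) ('X - z%:P) != 0 :> {poly F'}.
  by rewrite monic_neq0 // monic_prod_XsubC.
have : (size rs - k <= count_mem (f a) rs)%N.
  rewrite -mu_prod_XsubC mup_geq // -(eqp_dvdr _ eqp_p) -sz_rs.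
  by rewrite -(map_polyXsubC f) -rmorphXn dvdp_map.
by rewrite leq_subLR -(count_predC (pred1 (f a)) rs) addnC leq_add2r.
Qed.

(** Extending a matrix by zero amounts to multiplying it on both sides by the 0-1 inclusion matrices
    [P] and [Q], which cannot raise the rank. *)
Lemma rank_submatrix_extension (F : fieldType) (T : finType) (X Y : {set T})
    (g : T -> T -> F) :
  (\rank (\matrix_(i < #|T|, j < #|T|)
     (g (enum_val i) (enum_val j) *+
        ((enum_val i \in X) && (enum_val j \in Y)))) <=
   \rank (\matrix_(a < #|X|, b < #|Y|) g (enum_val a) (enum_val b)))%N.
Proof.
set G := (\matrix_(a < #|X|, b < #|Y|) _).
pose P : 'M[F]_(#|T|, #|X|) := \matrix_(i, a) (enum_val i == enum_val a)%:R.
pose Q : 'M[F]_(#|Y|, #|T|) := \matrix_(b, j) (enum_val b == enum_val j)%:R.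
rewrite [X in (\rank X <= _)%N](_ : _ = P *m G *m Q).
  exact: leq_trans (mxrankM_maxl _ _) (mxrankM_maxr _ _).
apply/matrixP => i j; rewrite !mxE.
have [Xi|X'i] /= := boolP (enum_val i \in X); last first.
  rewrite mulr0n big1 // => b _; rewrite !mxE big1 ?mul0r // => a _.
  rewrite !mxE; case: eqP => [eq_i|_]; last by rewrite mul0r.
  by case/negP: X'i; rewrite eq_i; apply: enum_valP.
have [Yj|Y'j] /= := boolP (enum_val j \in Y); last first.
  rewrite mulr0n big1 // => b _; rewrite !mxE.
  rewrite [X in _ * X](_ : _ = 0) ?mulr0 //; case: eqP => // eq_j.
  by case/negP: Y'j; rewrite -eq_j; apply: enum_valP.
rewrite (bigD1 (enum_rank_in Yj (enum_val j))) //= big1 => [|b]; last first.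
  move=> neq_b; rewrite [X in _ * X](_ : _ = 0) ?mulr0 // mxE.
  case: (enum_val b =P _) neq_b => [eq_b|//].
  by rewrite -(enum_valK_in Yj b) eq_b eqxx.
rewrite !mxE enum_rankK_in // eqxx mulr1 addr0.
rewrite (bigD1 (enum_rank_in Xi (enum_val i))) //= big1 => [|a]; last first.
  move=> neq_a; rewrite mxE.
  case: (_ =P enum_val a) neq_a => [eq_a|_ _]; last by rewrite mul0r.
  by rewrite -(enum_valK_in Xi a) -eq_a eqxx.
by rewrite !mxE !enum_rankK_in // eqxx mul1r addr0.
Qed.

Lemma rank_adjacency_mxD1 (T : finType) (e : rel T) (X Y : {set T}) :
    symmetric e -> irreflexive e -> [disjoint X & Y] ->
    (forall x y, x != y -> ~~ e x y ->
      (x \in X) && (y \in Y) || (x \in Y) && (y \in X)) ->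
  (\rank (adjacency_mx e - (-1)%:M)%R <= 2 * \rank (defect_mx e X Y) + 1)%N.
Proof.
move=> e_sym e_irr dXY nonadj.
pose M : 'M[rat]_#|T| := \matrix_(i, j) ((~~ e (enum_val i) (enum_val j))%:R *+
   ((enum_val i \in X) && (enum_val j \in Y))).
have rM : (\rank M <= \rank (defect_mx e X Y))%N.
  exact: (rank_submatrix_extension X Y (fun x y => (~~ e x y)%:R : rat)).
(* Since X and Y are disjoint, [M] and [M^T] never overlap and both vanish on the diagonal, where
   [A + 1] has entry 1. *)
have -> : adjacency_mx e - (-1)%:M = const_mx 1 - (M + M^T).
  apply/matrixP => i j; rewrite !mxE.
  rewrite [e (enum_val j) _]e_sym -(inj_eq enum_val_inj).
  move: (enum_val i) (enum_val j) => x y.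
  have XY z : z \in X -> z \in Y = false by apply: disjointFr.
  have [->|neq_xy] := eqVneq x y.
    by rewrite e_irr mulr1n opprK add0r; case Xy: (y \in X); rewrite /= ?XY.
  rewrite mulr0n subr0; case exy: (e x y) => /=; first by rewrite !mul0rn.
  have /orP[] := nonadj _ _ neq_xy (negbT exy) => /andP[hx hy].
    by rewrite hx hy (XY _ hx) andbF.
  by rewrite hx hy (XY _ hy) andbF.
have -> : const_mx 1 = (const_mx 1 : 'cV_#|T|) *m (const_mx 1 : 'rV[rat]_#|T|).
  by apply/matrixP => i j; rewrite !mxE big_ord1 !mxE mulr1.
apply: leq_trans (mxrank_add _ _) _; rewrite mxrank_opp addnC leq_add //.
  by apply: leq_trans (mxrank_add _ _) _; rewrite mxrank_tr addnn -mul2n leq_mul2l.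
exact: leq_trans (mxrankM_maxl _ _) (rank_leq_col _).
Qed.

Theorem theorem4p1 (T : finType) (e : rel T)
    (e_sym : symmetric e) (e_irr : irreflexive e)
    (U X Y : {set T}) (f : T -> T) (n1 n2 n3 n r : nat)
    (lewis_e : lewis_graph e)
    (partV : vertex_partition U X Y)
    (univU : U = universal_vertices e)
    (blocksXY : lewis_blocks e X Y)
    (cardU : #|U| = n1) (cardX : #|X| = n2) (cardY : #|Y| = n3)
    (complU : induces_complete e U)
    (complX : induces_complete e X)
    (complY : induces_complete e Y)
    (adjU : {in U & X :|: Y, forall u v, e u v})
    (surj_f : f @: X = Y)
    (nonadj_f : {in X & Y, forall x y, ~~ e x y <-> y = f x})
    (def_r : r = \rank (defect_mx e X Y))
    (def_n : n = (n1 + n2 + n3)%N) :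
  let A := adjacency_mx e in
  let chi := char_poly A in
  [/\ Num.max 0 (n%:Z - 1 - 2 * r%:Z) <= (mup (-1) chi)%:Z,
      (count (fun z : algC => (z != -1)%R) (eigenvalues A) <= 2 * r + 1)%N,
      forall p : {poly rat}, irreducible_poly p -> p %| chi ->
        (exists2 z : algC, root (map_poly ratr p) z & z != -1) ->
        ((size p).-1 <= 2 * r + 1)%N
    & forall K : fieldExtType rat,
        splittingFieldFor 1 (map_poly (in_alg K) chi) {:K} ->
        (\dim {:K} <= (2 * r + 1) ^ (2 * r + 1))%N].
Proof.
move=> A chi; set k := (2 * r + 1)%N.
have [_ dXY _ _ _] := blocksXY.
have [UXY dUX dUY _] := partV.
have def_card : #|T| = n.
  rewrite def_n -cardU -cardX -cardY -cardsT -UXY cardsU.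
  have -> : (U :|: X) :&: Y = set0.
    by apply/eqP; rewrite setIUl setU_eq0 !setI_eq0 dUY.
  rewrite cards0 subn0 cardsU (_ : U :&: X = set0) ?cards0 ?subn0 //.
  by apply/eqP; rewrite setI_eq0.
have rankA : (\rank (A - (-1)%:M)%R <= k)%N.
  (* Two distinct non-adjacent vertices lie one in X and one in Y: vertices of U are adjacent to all
     others, and X and Y are complete. *)
  rewrite /k def_r; apply: rank_adjacency_mxD1 => // x y neq_xy n_exy.
  have inUXY z : [|| z \in U, z \in X | z \in Y].
    by have := in_setT z; rewrite -UXY !inE orbA.
  have Ue z w : z \in U -> z != w -> e z w.
    move=> Uz neq_zw; have /or3P[Uw|Xw|Yw] := inUXY w; first exact: complU.
      by apply: adjU; rewrite ?inE ?Xw.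
    by apply: adjU; rewrite ?inE ?Yw ?orbT.
  have /negPf U'x : x \notin U by apply: contra n_exy => /Ue->.
  have /negPf U'y : y \notin U.
    by apply: contra n_exy => /Ue; rewrite e_sym; apply; rewrite eq_sym.
  have := inUXY x; have := inUXY y; rewrite U'x U'y /=.
  case/orP=> [Xy|Yy] /orP[Xx|Yx]; rewrite ?Xx ?Xy ?Yx ?Yy ?orbT //.
    by rewrite complX in n_exy.
  by rewrite complY in n_exy.
have monic_chi : chi \is monic := char_poly_monic A.
have chi_neq0 : chi != 0 := monic_neq0 monic_chi.
have size_chi : size chi = n.+1 by rewrite size_char_poly def_card.
have dvd_chi : ('X - (-1)%:P) ^+ (n - k) %| chi.
  apply: dvdp_trans (exp_rank_dvdp_char_poly A (-1)).
  by rewrite dvdp_exp2l // -def_card leq_sub2l.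
have [q def_chi] := dvdpP _ _ dvd_chi.
have q_neq0 : q != 0.
  by apply: contraNneq chi_neq0 => q0; rewrite def_chi q0 mul0r.
(* The subtraction n - k is truncated, but n <= k + (n - k) holds in every case, including n < k,
   where q is [chi] itself. *)
have size_q : (size q <= k.+1)%N.
  move: size_chi; rewrite def_chi size_mul ?expf_neq0 ?polyXsubC_eq0 //.
  rewrite size_exp_XsubC addnS /= => sz.
  by rewrite -(leq_add2r (n - k)) sz addSn ltnS -leq_subLR.
have mup_chi : (n - k <= mup (-1) chi)%N by rewrite mup_geq.
split.
- rewrite ge_max lez_nat leq0n /=; move: mup_chi; rewrite /k.
  by move: (mup _ _) => m; lia.
- have := @count_split_roots_neq _ algC ratr chi (-1) k (eigenvalues A) chi_neq0.
  rewrite size_chi => /(_ dvd_chi); rewrite rmorphN1 eigenvaluesP; apply.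
  exact: eqpxx.
- move=> p irr_p; rewrite def_chi => p_dvd [z pz z_neq].
  (* If p divided X + 1, its root z would be -1. *)
  have co_p : coprimep p ('X - (-1)%:P).
    rewrite irreducible_poly_coprime //; apply: contraNN z_neq => p_dvd1.
    have: root (map_poly ratr ('X - (-1)%:P)) z.
      rewrite -!dvdp_XsubCl in pz *.
      by apply: dvdp_trans pz _; rewrite dvdp_map.
    by rewrite map_polyXsubC root_XsubC rmorphN1.
  rewrite Gauss_dvdpl ?coprimep_expr // in p_dvd.
  by rewrite -subn1 leq_subLR add1n (leq_trans (dvdp_leq q_neq0 p_dvd)).
- move=> K [rs eqp_rs <-].
  (* Since -1 lies in the base field, every root outside it differs from -1. *)
  have count_rs : (count [pred z | z \notin 1%VS] rs <= k)%N.
    have := @count_split_roots_neq _ _ (in_alg K) chi (-1) k rs chi_neq0.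
    rewrite size_chi => /(_ dvd_chi eqp_rs); apply: leq_trans.
    apply: sub_count => z /=; apply: contraNneq => ->.
    by rewrite scaleN1r rpredN1.
  have k_gt0 : (0 < k)%N by rewrite /k addn1.
  apply: leq_trans (_ : k ^ count [pred z | z \notin 1%VS] rs <= _)%N; last first.
    by rewrite leq_pexp2l.
  apply: (@dim_adjoin_seq_leq _ _ _ (map_poly (in_alg K) q)) => //.
  + by apply/polyOver1P; exists q.
  + by rewrite map_poly_eq0.
  + by rewrite size_map_poly.
  move=> z rs_z.
  have : root (map_poly (in_alg K) chi) z.
    by rewrite (eqp_root eqp_rs) root_prod_XsubC.
  rewrite def_chi rmorphM rmorphXn /= map_polyXsubC rootM => /orP[->//|].
  (* For n - k = 0 the power of X + 1 is 1 and has no root; otherwise z is -1, an element of the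
     base field. *)
  case: (n - k)%N => [|m]; first by rewrite expr0 (negPf (root1 _)).
  by rewrite root_exp_XsubC /= scaleN1r => /eqP->; rewrite rpredN1 orbT.
Qed.
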